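(* Let $d, k$ be natural numbers. Let $G$ be a graph with pairwise disjoint vertex subsets $V_1,\dots,V_k$, let $H$ be a graph with a vertex partition $W_1,\dots,W_k$ into independent sets such that for each $i\in[k-1]$ every vertex of $W_i$ has at most $d$ neighbors in $W_{i+1}\cup\cdots\cup W_k$, and let $\theta_1,\dots,\theta_{k-1}$ be natural numbers. Let $\psi$ be the random map produced by the random greedy process described in the context. If $|V_k| \ge 2|W_k|$ and $\theta_i \ge 2|W_i|$ for all $i \in [k-1]$, then the probability that $\psi$ does not induce an embedding of $H$ in $G$ is at most $2^{2d+2}\gamma^{2d} \mu_{4d} \sum_{i \in [k-1]} \frac{|W_i|}{\theta_i}$.
   Context: Notation. For a graph $G$, a vertex set $T$ and an ordered tuple $Q$ of vertices, $N(Q;T)$ is the set of vertices of $T$ adjacent to every vertex appearing in $Q$. For a real $\theta>0$, the $\theta$-defect is $\omega_\theta(Q;T)=0$ if $|N(Q;T)|\ge\theta$ and $\omega_\theta(Q;T)=\theta/|N(Q;T)|$ otherwise (equal to $+\infty$ if $N(Q;T)=\emptyset$). For a nonempty set $\mathcal{Q}$ of $d$-tuples and natural $s$, $\mu_{s,\theta}(\mathcal{Q};T)=\frac{1}{|\mathcal{Q}|}\sum_{Q\in\mathcal{Q}}\omega_\theta(Q;T)^s$. An embedding of $H$ in $G$ is an injective map $V(H)\to V(G)$ sending edges to edges. Setup. Add edges to $H$ (each between a vertex of some $W_i$, $i\le k-1$, and a vertex of $W_{i+1}\cup\cdots\cup W_k$) so that every $x\in W_i$, $i\in[k-1]$, has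 exactly $d$ neighbors in $W_{i+1}\cup\cdots\cup W_k$; call this set $N^+(x)$, and let $e_x$ be a fixed ordering of $N^+(x)$ as a $d$-tuple. For a map $\psi$, $\psi(e_x)$ denotes the $d$-tuple of images. Random greedy process defining $\psi:V(H)\to V(G)$: (1) Map $W_k$ to $V_k$ by an injection chosen uniformly at random. (2) For $i=k-1,k-2,\dots,1$: given $\psi$ on $W_{i+1}\cup\cdots\cup W_k$, order the vertices of $W_i$ as $x_1,\dots,x_m$ so that $\omega_{\theta_i}(\psi(e_{x_j});V_i)$ is non-increasing in $j$ (ties broken arbitrarily). (3) For $j=1,\dots,m$ in turn, let $e_j=e_{x_j}$ and $L_j=N(\psi(e_j);V_i)\setminus\{\psi(x_1),\dots,\psi(x_{j-1})\}$, and define $\psi(x_j)$ by the first applicable rule: (3-1) if $N(\psi(e_j);V_i)=\emptyset$, $\psi(x_j)$ is uniform in $V_i$; (3-2) if $|L_j|<\frac12|N(\psi(e_j);V_i)|$, $\psi(x_j)$ is uniform in $N(\psi(e_j);V_i)$; (3-3) if $|L_j|\ge\frac12|N(\psi(e_j);V_i)|$, $\psi(x_j)$ is uniform in $L_j$. Parameters. For $i\in[k-1]$ and $x\in W_i$: $\theta_x=\theta_i$, $V_x=V_i$, $\mathcal{Q}_x=V_{i_1}\times\cdots\times V_{i_d}$ where $W_{i_1}\times\cdots\times W_{i_d}$ is the product of parts containing $e_x$, and $\mu_s(x)=\mu_{s,\theta_x}(\mathcal{Q}_x;V_x)$. Let $\mu_s=\max_x\mu_s(x)$ over $x\in W_1\cup\cdots\cup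 W_{k-1}$, and $\gamma=\max\{1,\max_{i\in[k-1]}|V_i|/\theta_i\}$. *)

(* Defs.v *)
From mathcomp Require Import all_boot all_order all_algebra.
From mathcomp Require Import reals constructive_ereal.

Set Implicit Arguments.
Unset Strict Implicit.
Unset Printing Implicit Defensive.

Import Order.TTheory GRing.Theory Num.Theory.

Local Open Scope ring_scope.

(* A law on a finite type is represented by its mass function. *)

Definition dist (R : realType) (T : finType) := {ffun T -> R}.

Definition dret (R : realType) (T : finType) (a : T) : dist R T :=
  [ffun b => (b == a)%:R].

(* For A = set0 this is the zero mass function. *)
Definition dunif (R : realType) (T : finType) (A : {set T}) : dist R T :=
  [ffun b => (b \in A)%:R / #|A|%:R].

Definition dbind (R : realType) (S T : finType)
    (p : dist R S) (f : S -> dist R T) : dist R T :=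
  [ffun b => \sum_(a : S) p a * f a b].

Definition Pr (R : realType) (T : finType) (p : dist R T) (E : pred T) : R :=
  \sum_(a | E a) p a.

Definition simple_graph (T : finType) (g : rel T) : Prop :=
  symmetric g /\ irreflexive g.

Definition is_embedding (VH VG : finType) (H : rel VH) (G : rel VG)
    (psi : {ffun VH -> VG}) : bool :=
  injectiveb psi && [forall x, forall y, H x y ==> G (psi x) (psi y)].

(* N(Q;T); the tuple Q enters only through its entries. *)
Definition common_nbrs (VG : finType) (G : rel VG) (Q : seq VG) (T : {set VG})
    : {set VG} :=
  [set v in T | all (fun u => G v u) Q].

Definition defect (R : realType) (VG : finType) (G : rel VG) (theta : R)
    (Q : seq VG) (T : {set VG}) : \bar R :=
  let N := common_nbrs G Q T in
  if theta <= #|N|%:R then 0%E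
  else if N == set0 then +oo%E
  else (theta / #|N|%:R)%:E.

Definition avg_defect (R : realType) (VG : finType) (G : rel VG) (s : nat)
    (theta : R) (d : nat) (QQ : {set d.-tuple VG}) (T : {set VG}) : \bar R :=
  ((#|QQ|%:R^-1)%:E * \sum_(Q in QQ) defect G theta Q T ^+ s)%E.

(* The partition W_1, ..., W_k of V(H) is the labelling part : VH -> 'I_k, the
   index i : 'I_k standing for i + 1; "i \in [k-1]" is thus i.+1 < k, and the
   last part W_k consists of the x with (part x).+1 == k. *)

Definition block (VH : finType) (k : nat) (part : VH -> 'I_k) (i : 'I_k)
    : {set VH} :=
  [set x | part x == i].

Definition later_nbrs (VH : finType) (k : nat) (part : VH -> 'I_k)
    (H : rel VH) (x : VH) : {set VH} :=
  [set y | H x y & (part x < part y)%N].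

(* Hd is H plus some edges between distinct parts, such that every vertex
   outside the last part has exactly d neighbours in later parts. *)
Record regular_completion (VH : finType) (k : nat) (part : VH -> 'I_k)
    (d : nat) (H Hd : rel VH) : Prop := RegularCompletion {
  completion_simple : simple_graph Hd;
  completion_sub : forall x y, H x y -> Hd x y;
  completion_new : forall x y, Hd x y -> ~~ H x y -> part x != part y;
  completion_deg : forall x, ((part x).+1 < k)%N ->
    #|later_nbrs part Hd x| = d
}.

Definition is_ordering_of_later_nbrs (VH : finType) (k : nat)
    (part : VH -> 'I_k) (d : nat) (Hd : rel VH) (e : VH -> d.-tuple VH)
    : Prop :=
  forall x, ((part x).+1 < k)%N -> perm_eq (e x) (enum (later_nbrs part Hd x)).

Section Process.

Context (R : realType) (VG VH : finType) (G : rel VG) (k d : nat).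
Context (V : 'I_k -> {set VG}) (part : VH -> 'I_k) (theta : 'I_k -> nat).
Context (e : VH -> d.-tuple VH).

(* sigma i psi is the order x_1, ..., x_m in which W_i is processed when psi is
   the map built so far; its freedom is the arbitrary breaking of ties. *)
Definition valid_orders (sigma : 'I_k -> {ffun VH -> VG} -> seq VH) : Prop :=
  forall (i : 'I_k) (psi : {ffun VH -> VG}), (i.+1 < k)%N ->
    perm_eq (sigma i psi) (enum (block part i)) /\
    sorted (fun x y =>
        (defect G (theta i)%:R (map_tuple psi (e y)) (V i)
         <= defect G ((theta i)%:R : R) (map_tuple psi (e x)) (V i))%E)
      (sigma i psi).

(* The set in which psi(x_j) is drawn, for x = x_j and
   prev = [:: x_1; ...; x_(j-1)]. It is empty only if V i is. *)
Definition choices (i : 'I_k) (prev : seq VH) (x : VH) (psi : {ffun VH -> VG})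
    : {set VG} :=
  let N := common_nbrs G (map_tuple psi (e x)) (V i) in
  let L := [set v in N | v \notin map psi prev] in
  if N == set0 then V i
  else if (2 * #|L| < #|N|)%N then N
  else L.

Fixpoint embed_seq (i : 'I_k) (prev todo : seq VH) (psi : {ffun VH -> VG})
    : dist R {ffun VH -> VG} :=
  if todo is x :: todo' then
    dbind (dunif R (choices i prev x psi)) (fun v =>
      embed_seq i (rcons prev x) todo' [ffun y => if y == x then v else psi y])
  else dret R psi.

(* psi0 only supplies placeholder values for vertices not yet embedded, so that
   the map built so far can be a total function. *)
Definition start_maps (psi0 : {ffun VH -> VG}) : {set {ffun VH -> VG}} :=
  [set psi : {ffun VH -> VG} |
    [forall x, if (part x).+1 == k then psi x \in V (part x)
               else psi x == psi0 x] &&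
    [forall x, forall y, ((part x).+1 == k) && ((part y).+1 == k) ==>
                         (psi x == psi y) ==> (x == y)]].

Definition greedy_map (sigma : 'I_k -> {ffun VH -> VG} -> seq VH)
    (psi0 : {ffun VH -> VG}) : dist R {ffun VH -> VG} :=
  foldl (fun law i => dbind law (fun psi => embed_seq i [::] (sigma i psi) psi))
        (dunif R (start_maps psi0))
        (rev [seq i : 'I_k <- enum 'I_k | (i.+1 < k)%N]).

Definition target_tuples (x : VH) : {set d.-tuple VG} :=
  [set Q : d.-tuple VG |
    [forall t, tnth Q t \in V (part (tnth (e x) t))]].

Definition mu_at (s : nat) (x : VH) : \bar R :=
  avg_defect G s (theta (part x))%:R (target_tuples x) (V (part x)).

Definition mu_max (s : nat) : \bar R :=
  \big[Order.max/0%E]_(x : VH | ((part x).+1 < k)%N) mu_at s x.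

Definition gamma : R :=
  \big[Order.max/1]_(i < k | (i.+1 < k)%N) (#|V i|%:R / (theta i)%:R).

End Process.

(* Main.v *)
Require Import Defs.
From mathcomp Require Import all_boot all_order all_algebra.
From mathcomp Require Import reals constructive_ereal.
From mathcomp Require Import ring lra zify.

Set Implicit Arguments.
Unset Strict Implicit.
Unset Printing Implicit Defensive.

Import Order.TTheory GRing.Theory Num.Theory.

Local Open Scope ring_scope.

(* Write w_x for the defect of psi(e_x), set to 0 for x in W_k, and
   f_x := max(1, w_x). If psi is not an embedding, then some W_i contains a vertex
   x_j with empty or crowded common neighbourhood, and since W_i is processed by
   non-increasing defect the sum of w_x over W_i is then at least theta_i / 2. By
   Markov's inequality it remains to bound E[w_x] by 2^(2d+1) gamma^(2d) mu_{4d}.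

   Given the past, psi(y) takes each value with probability at most
   2 gamma f_y / |V_y|; hence E[w_x^(4d) / prod_y f_y] <= (2 gamma)^d mu_{4d},
   with y ranging over N^+(x). Since prod_y f_y is 1 or at most
   S := sum_y w_y^d, and w_x is 0 or at least 1, AM-GM gives
   w_x^d <= d w_x^(4d) / prod_y f_y + S / (4d), and induction from the last part
   backwards yields E[w_x^d] <= 2d (2 gamma)^d mu_{4d}. If mu_{4d} is infinite, so
   is the bound; otherwise no common neighbourhood met by the process is empty. *)

(** * Expectations under finite mass functions *)

Section Expectation.

Context (R : realType).

Definition expect (T : finType) (p : dist R T) (F : T -> R) : R :=
  \sum_a p a * F a.

(** Total mass at most 1, rather than equal to 1, covers the uniform law on an empty set, which is
    the zero mass function; upper bounds on expectations of nonnegative functions survive this. *)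
Definition subdist (T : finType) (p : dist R T) : Prop :=
  (forall a, 0 <= p a) /\ \sum_a p a <= 1.

Lemma expect_dbind (S T : finType) (p : dist R S) (f : S -> dist R T) F :
  expect (dbind p f) F = expect p (fun a => expect (f a) F).
Proof.
rewrite /expect; under eq_bigr => b _ do rewrite ffunE big_distrl /=.
rewrite exchange_big /=; apply: eq_bigr => a _.
by rewrite big_distrr /=; apply: eq_bigr => b _; rewrite mulrA.
Qed.

Lemma expect_dret (T : finType) (a : T) F : expect (dret R a) F = F a.
Proof.
rewrite /expect (bigD1 a) //= ffunE eqxx mul1r big1 ?addr0 // => b /negPf hb.
by rewrite ffunE hb mul0r.
Qed.

Lemma expect_dunif (T : finType) (A : {set T}) F :
  expect (dunif R A) F = (\sum_(a in A) F a) / #|A|%:R.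
Proof.
rewrite /expect big_distrl /= [RHS]big_mkcond /=; apply: eq_bigr => a _.
by rewrite ffunE; case: (a \in A); rewrite ?mul0r // mul1r mulrC.
Qed.

Lemma ler_expect (T : finType) (p : dist R T) (F1 F2 : T -> R) :
  subdist p -> (forall a, p a != 0 -> F1 a <= F2 a) ->
  expect p F1 <= expect p F2.
Proof.
move=> [p0 _] h; apply: ler_sum => a _; have [->|ha] := eqVneq (p a) 0.
  by rewrite !mul0r.
by rewrite ler_wpM2l // h.
Qed.

Lemma expect_sum (T I : finType) (P : pred I) (p : dist R T) (F : I -> T -> R) :
  expect p (fun a => \sum_(i | P i) F i a) = \sum_(i | P i) expect p (F i).
Proof.
by rewrite exchange_big /=; apply: eq_bigr => a _; rewrite big_distrr.
Qed.

Lemma expectD (T : finType) (p : dist R T) (F1 F2 : T -> R) :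
  expect p (fun a => F1 a + F2 a) = expect p F1 + expect p F2.
Proof. by rewrite -big_split; apply: eq_bigr => a _; rewrite mulrDr. Qed.

Lemma expectZ (T : finType) (p : dist R T) (c : R) (F : T -> R) :
  expect p (fun a => c * F a) = c * expect p F.
Proof. by rewrite big_distrr /=; apply: eq_bigr => a _; rewrite mulrCA. Qed.

Lemma expect_cst_le (T : finType) (p : dist R T) (c : R) :
  subdist p -> 0 <= c -> expect p (fun=> c) <= c.
Proof. by move=> [_ p1] c0; rewrite /expect -big_distrl /= ler_piMl. Qed.

Lemma Pr_le_expect (T : finType) (p : dist R T) (E : pred T) (F : T -> R) :
  subdist p -> (forall a, 0 <= F a) ->
  (forall a, p a != 0 -> E a -> 1 <= F a) -> Pr p E <= expect p F.
Proof.
move=> [p0 _] F0 h; rewrite /Pr /expect big_mkcond /=.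
apply: ler_sum => a _; case: ifP => [Ea|_]; last exact: mulr_ge0.
have [->|ha] := eqVneq (p a) 0; first by rewrite mul0r.
by rewrite ler_peMr // h.
Qed.

Lemma subdist_dret (T : finType) (a : T) : subdist (dret R a).
Proof.
split=> [b|]; first by rewrite ffunE ler0n.
rewrite (bigD1 a) //= ffunE eqxx big1 ?addr0 // => b /negPf hb.
by rewrite ffunE hb.
Qed.

Lemma subdist_dunif (T : finType) (A : {set T}) : subdist (dunif R A).
Proof.
split=> [b|]; first by rewrite ffunE divr_ge0 ?ler0n.
under eq_bigr => b _ do rewrite ffunE.
rewrite -big_distrl /= -natr_sum.
have -> : (\sum_i (i \in A))%N = #|A|.
  by rewrite -sum1_card [RHS]big_mkcond; apply: eq_bigr => i _; case: (i \in A).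
have [->|hA] := eqVneq (#|A|%:R : R) 0; first by rewrite mul0r.
by rewrite divff.
Qed.

Lemma subdist_dbind (S T : finType) (p : dist R S) (f : S -> dist R T) :
  subdist p -> (forall a, subdist (f a)) -> subdist (dbind p f).
Proof.
move=> [p0 p1] hf; split=> [b|].
  by rewrite ffunE sumr_ge0 // => a _; rewrite mulr_ge0 //; apply: (hf a).1.
under eq_bigr => b _ do rewrite ffunE.
rewrite exchange_big /=; apply: le_trans p1; apply: ler_sum => a _.
by rewrite -big_distrr /= ler_piMr //; apply: (hf a).2.
Qed.

Lemma dbind_neq0 (S T : finType) (p : dist R S) (f : S -> dist R T) b :
  dbind p f b != 0 -> exists2 a, p a != 0 & f a b != 0.
Proof.
rewrite ffunE => h; have /existsP [a] : [exists a, p a * f a b != 0].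
  apply: contraNT h => /existsPn h; apply/eqP; rewrite big1 // => a _.
  by apply/eqP; rewrite -[_ == _]negbK h.
by rewrite mulf_eq0 negb_or => /andP [h1 h2]; exists a.
Qed.

Lemma dunif_neq0 (T : finType) (A : {set T}) b : dunif R A b != 0 -> b \in A.
Proof. by rewrite ffunE; case: (b \in A); rewrite // mul0r eqxx. Qed.

Lemma dret_neq0 (T : finType) (a b : T) : dret R a b != 0 -> b = a.
Proof. by rewrite ffunE; case: (b =P a); rewrite ?eqxx. Qed.

End Expectation.

(** The invariant is indexed by the prefix already consumed, because what is known about the law
    depends on which parts have been embedded. *)
Lemma foldl_inv (A I : Type) (f : A -> I -> A) (P : seq I -> A -> Prop)
    (l : seq I) (a : A) :
  P [::] a ->
  (forall l1 i l2 a, l = l1 ++ i :: l2 -> P l1 a -> P (rcons l1 i) (f a i)) ->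
  P l (foldl f a l).
Proof.
move=> P0 Pstep.
have gen l1 l2 b : l = l1 ++ l2 -> P l1 b -> P l (foldl f b l2).
  elim: l2 l1 b => [|i l2 IH] l1 b /= hl Pb; first by rewrite hl cats0.
  by apply: (IH (rcons l1 i)); [rewrite cat_rcons | apply: Pstep Pb; exact: hl].
exact: (gen [::]).
Qed.

(** * The order in which the parts are processed *)

Definition descending_indices (k : nat) : seq 'I_k :=
  rev [seq i : 'I_k <- enum 'I_k | (i.+1 < k)%N].

Lemma mem_descending_indices k (i : 'I_k) :
  (i \in descending_indices k) = (i.+1 < k)%N.
Proof. by rewrite mem_rev mem_filter mem_enum andbT. Qed.

Lemma descending_indices_split k (l1 l2 : seq 'I_k) i :
  descending_indices k = l1 ++ i :: l2 ->
  (i.+1 < k)%N /\ forall j, j \in l1 -> (i < j)%N.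
Proof.
move=> hl.
have hs : pairwise (fun i j : 'I_k => (j < i)%N) (descending_indices k).
  rewrite -sorted_pairwise; last by move=> a b c /= h1 h2; apply: ltn_trans h2 h1.
  rewrite rev_sorted; apply: sorted_filter; first exact: ltn_trans.
  rewrite -(map_id (enum 'I_k)) -[sorted _ _](@sorted_map _ _ val ltn).
  by rewrite map_id val_enum_ord iota_ltn_sorted.
have hi : i \in descending_indices k by rewrite hl mem_cat inE eqxx orbT.
split; first by rewrite -mem_descending_indices.
move=> j hj; move: hs; rewrite hl pairwise_cat => /and3P [h _ _].
by move/allrelP: h => /(_ j i hj); apply; rewrite inE eqxx.
Qed.


(* Real-valued defect: it differs from [defect] only when N(Q;T) is empty, where
   it is 0 instead of +oo. *)
Definition rdefect (R : realType) (VG : finType) (G : rel VG) (theta : nat)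
    (Q : seq VG) (T : {set VG}) : R :=
  let N := common_nbrs G Q T in
  if (theta <= #|N|)%N then 0 else theta%:R / #|N|%:R.

Section RealDefect.

Context (R : realType) (VG : finType) (G : rel VG).

(** The gap between 0 and 1 makes positive powers of a defect increase with the exponent. An empty
    neighbourhood falls under the first case, since division by zero gives 0. *)
Lemma rdefect_eq0_or_ge1 theta (Q : seq VG) (T : {set VG}) :
  rdefect R G theta Q T = 0 \/ 1 <= rdefect R G theta Q T.
Proof.
rewrite /rdefect; case: leqP => h; first by left.
have [->|N0] := posnP #|common_nbrs G Q T|; first by rewrite invr0 mulr0; left.
by right; rewrite ler_pdivlMr ?ltr0n // mul1r ler_nat ltnW.
Qed.

Lemma defectE theta (Q : seq VG) (T : {set VG}) :
  common_nbrs G Q T != set0 ->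
  defect G (theta%:R : R) Q T = (rdefect R G theta Q T)%:E.
Proof. by move=> /negPf h; rewrite /defect /rdefect h ler_nat; case: leqP. Qed.

End RealDefect.

(** * Defects, one-step densities and the potential *)

Section Process.

Context (R : realType) (VG VH : finType) (G : rel VG) (k d : nat).
Context (V : 'I_k -> {set VG}) (part : VH -> 'I_k) (theta : 'I_k -> nat).
Context (e : VH -> d.-tuple VH).
Context (theta_gt0 : forall i : 'I_k, (i.+1 < k)%N -> (0 < theta i)%N).
Context (e_uniq : forall x, ((part x).+1 < k)%N -> uniq (e x)).
Context (e_later : forall x z,
  ((part x).+1 < k)%N -> z \in e x -> (part x < part z)%N).

Implicit Types (psi : {ffun VH -> VG}) (D : {set VH}) (x y z : VH).

Definition upd psi x (v : VG) : {ffun VH -> VG} :=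
  [ffun y => if y == x then v else psi y].

Lemma updE psi x v y : upd psi x v y = if y == x then v else psi y.
Proof. by rewrite ffunE. Qed.

(* The convention 0 on the last part makes its vertices neutral in the products
   below. *)
Definition vdefect x psi : R :=
  if ((part x).+1 < k)%N
  then rdefect R G (theta (part x)) (map_tuple psi (e x)) (V (part x)) else 0.

Definition vfactor x psi : R := Num.max 1 (vdefect x psi).

Local Notation gam := (gamma R V theta).

Definition rate x : R := 2 * gam / #|V (part x)|%:R.

(* With D the set of vertices embedded so far, this is a supermartingale of the
   process: the law of psi y has density at most [rate y * vfactor y psi]. *)
Definition potential x (Q : d.-tuple VG) D psi : R :=
  \prod_(t < d) let y := tnth (e x) t in
    if y \in D then (psi y == tnth Q t)%:R / vfactor y psi else rate y.

Lemma vdefect_eq0_or_ge1 x psi : vdefect x psi = 0 \/ 1 <= vdefect x psi.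
Proof. by rewrite /vdefect; case: ifP => _; [exact: rdefect_eq0_or_ge1|left]. Qed.

Lemma vdefect_ge0 x psi : 0 <= vdefect x psi.
Proof. by case: (vdefect_eq0_or_ge1 x psi) => [->//|]; apply: le_trans. Qed.

Lemma vfactor_ge1 x psi : 1 <= vfactor x psi.
Proof. by rewrite le_max lexx. Qed.

Lemma vfactor_gt0 x psi : 0 < vfactor x psi.
Proof. exact: lt_le_trans ltr01 (vfactor_ge1 x psi). Qed.

Lemma gamma_ge1 : 1 <= gam.
Proof. exact: bigmax_ge_id. Qed.

Lemma gamma_ge (i : 'I_k) : (i.+1 < k)%N -> #|V i|%:R <= gam * (theta i)%:R.
Proof.
move=> hi; rewrite -ler_pdivrMr ?ltr0n ?theta_gt0 //.
exact: (le_bigmax_cond 1 (fun i => #|V i|%:R / (theta i)%:R : R)).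
Qed.

Lemma rate_ge0 x : 0 <= rate x.
Proof.
by rewrite divr_ge0 ?ler0n // mulr_ge0 ?ler0n // (le_trans ler01 gamma_ge1).
Qed.

Lemma potential_ge0 x Q D psi : 0 <= potential x Q D psi.
Proof.
apply: prodr_ge0 => t _ /=; case: ifP => _; last exact: rate_ge0.
by rewrite divr_ge0 ?ler0n // ltW // vfactor_gt0.
Qed.

Lemma map_tuple_agree psi psi' x :
  (forall z, z \in e x -> psi z = psi' z) ->
  map_tuple psi (e x) = map_tuple psi' (e x).
Proof. by move=> h; apply/val_inj/eq_in_map. Qed.

Lemma vdefect_agree x psi psi' :
  (forall z, (part x < part z)%N -> psi z = psi' z) ->
  vdefect x psi = vdefect x psi'.
Proof.
move=> h; rewrite /vdefect; case: ifP => // hx.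
by rewrite (@map_tuple_agree _ psi') // => z hz; apply: h; apply: e_later.
Qed.

(** The factor of [y] reads only values on parts later than that of [y], so it is frozen once the
    process has reached that part. *)
Lemma vfactor_upd x y psi v :
  (part x <= part y)%N -> vfactor y (upd psi x v) = vfactor y psi.
Proof.
move=> h; rewrite /vfactor (@vdefect_agree _ _ psi) // => z hz.
by rewrite updE; case: eqP => // zx; move: hz; rewrite zx ltnNge h.
Qed.

Lemma common_nbrs_sub (Q : seq VG) (T : {set VG}) : common_nbrs G Q T \subset T.
Proof. by apply/subsetP => v; rewrite inE => /andP []. Qed.

Lemma choices_sub i prev x psi : choices G V e i prev x psi \subset V i.
Proof.
rewrite /choices; case: ifP => // _; case: ifP => _; first exact: common_nbrs_sub.
apply: subset_trans (common_nbrs_sub (map_tuple psi (e x)) _).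
by apply/subsetP => v; rewrite inE => /andP [].
Qed.

Lemma card_choices i prev x psi :
  (#|common_nbrs G (map_tuple psi (e x)) (V i)| <=
    2 * #|choices G V e i prev x psi|)%N.
Proof.
rewrite /choices; case: eqP => [->|_]; first by rewrite cards0.
by case: ltnP => // _; rewrite leq_pmull.
Qed.

(** With N the common neighbourhood, the drawing set C has at least |N| / 2 elements, and |V_x| is
    at most gamma theta_x. Either |N| >= theta_x, or the factor is at least theta_x / |N|; both give
    |V_x| <= 2 gamma f_x |C|. If N is empty then C = V_x, and 2 gamma f_x >= 1 suffices. *)
Lemma dunif_choices_le x prev psi v : ((part x).+1 < k)%N ->
  dunif R (choices G V e (part x) prev x psi) v <= rate x * vfactor x psi.
Proof.
move=> hx; rewrite ffunE; set C := choices _ _ _ _ _ _ _.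
have r0 : 0 <= rate x * vfactor x psi.
  by rewrite mulr_ge0 ?rate_ge0 // ltW // vfactor_gt0.
have [vC|_] := boolP (v \in C); last by rewrite mul0r.
have vV : v \in V (part x) by apply: subsetP vC; apply: choices_sub.
have C0 : 0 < (#|C|%:R : R) by rewrite ltr0n (cardD1 v) vC.
have V0 : 0 < (#|V (part x)|%:R : R) by rewrite ltr0n (cardD1 v) vV.
have hg := gamma_ge hx; have g1 := gamma_ge1.
have th0 : 0 < ((theta (part x))%:R : R) by rewrite ltr0n theta_gt0.
rewrite ler_pdivrMr //=.
suff h : #|V (part x)|%:R <= 2 * gam * vfactor x psi * #|C|%:R.
  have -> : rate x * vfactor x psi * #|C|%:R = 2 * gam * vfactor x psi * #|C|%:R / #|V (part x)|%:R.
    by rewrite /rate; ring.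
  by rewrite ler_pdivlMr // mul1r.
have [N0|N0] := eqVneq (common_nbrs G (map_tuple psi (e x)) (V (part x))) set0.
  have -> : C = V (part x) by rewrite /C /choices N0 eqxx.
  rewrite -{1}[_%:R]mul1r ler_pM2r //.
  have f1 := vfactor_ge1 x psi; nra.
have := card_choices (part x) prev x psi; rewrite -/C.
rewrite /vfactor /vdefect hx /rdefect.
set N := common_nbrs _ _ _ in N0 *.
have N1 : 0 < (#|N|%:R : R) by rewrite ltr0n card_gt0.
rewrite -(ler_nat R) natrM => hNC.
case: leqP => hN.
  rewrite maxEle ler10 mulr1; apply: le_trans hg _.
  rewrite [2 * gam]mulrC -mulrA ler_wpM2l ?(le_trans ler01) //.
  by apply: le_trans hNC; rewrite ler_nat.
have : (theta (part x))%:R / #|N|%:R <= Num.max 1 ((theta (part x))%:R / #|N|%:R) :> R.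
  by rewrite le_max lexx orbT.
move: (Num.max _ _) => f hf; apply: le_trans hg _.
rewrite [2 * gam]mulrC -!mulrA ler_wpM2l ?(le_trans ler01) //.
have f0 : 0 <= f by apply: le_trans hf; rewrite divr_ge0 ?ler0n.
rewrite ler_pdivrMr // in hf; apply: le_trans hf _.
by rewrite mulrCA; apply: ler_wpM2l.
Qed.

(** * The potential does not increase in expectation while one part is embedded *)

Lemma subdist_embed_seq i prev todo psi :
  subdist (embed_seq R G V e i prev todo psi).
Proof.
elim: todo prev psi => [|x todo IH] prev psi /=; first exact: subdist_dret.
by apply: subdist_dbind => [|v]; [exact: subdist_dunif | exact: IH].
Qed.

(** Only the coordinate of [e x0] equal to [x] is affected, and there is at most one. There [rate x]
    is replaced by an indicator divided by [vfactor x psi], whose mean is at most [rate x] by the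
    density bound. *)
Lemma expect_potential_step (i : 'I_k) prev x psi x0 Q D :
  (i.+1 < k)%N -> ((part x0).+1 < k)%N -> part x = i -> x \notin D ->
  (forall y, y \in D -> (i <= part y)%N) ->
  expect (dunif R (choices G V e i prev x psi))
    (fun v => potential x0 Q (x |: D) (upd psi x v)) <= potential x0 Q D psi.
Proof.
move=> hi hx0 hx xD hD.
have same t v : tnth (e x0) t != x ->
  (let y := tnth (e x0) t in if y \in x |: D
    then (upd psi x v y == tnth Q t)%:R / vfactor y (upd psi x v) else rate y) =
  (let y := tnth (e x0) t in if y \in D
    then (psi y == tnth Q t)%:R / vfactor y psi else rate y).
  move=> /= /negPf ht; rewrite !inE ht /= updE ht; case: ifP => // yD.
  by rewrite vfactor_upd // hx; apply: hD.
have [/tnthP [t ht]|xe] := boolP (x \in e x0); last first.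
  rewrite (_ : expect _ _ = expect (dunif R (choices G V e i prev x psi))
    (fun=> potential x0 Q D psi)).
    exact: expect_cst_le (subdist_dunif _ _) (potential_ge0 _ _ _ _).
  apply: eq_bigr => v _; congr (_ * _); apply: eq_bigr => t _; apply: same.
  by apply: contraNneq xe => <-; apply: mem_tnth.
pose rest := \prod_(t' < d | t' != t) let y := tnth (e x0) t' in
  if y \in D then (psi y == tnth Q t')%:R / vfactor y psi else rate y.
have rest0 : 0 <= rest.
  apply: prodr_ge0 => t' _ /=; case: ifP => _; last exact: rate_ge0.
  by rewrite divr_ge0 ?ler0n // ltW // vfactor_gt0.
have -> : potential x0 Q D psi = rate x * rest.
  by rewrite /potential (bigD1 t) //= -ht (negPf xD).
have E v : potential x0 Q (x |: D) (upd psi x v) =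
    (v == tnth Q t)%:R / vfactor x psi * rest.
  rewrite /potential (bigD1 t) //= -ht setU11 updE eqxx vfactor_upd //.
  congr (_ * _); apply: eq_bigr => t' ht'; apply: same.
  rewrite ht; apply: contraNneq ht' => h; apply/eqP.
  by apply: (tuple_uniqP _ (e_uniq hx0)).
(* The indicator leaves a single value of v, so the expectation is one probability times a
   constant. *)
rewrite /expect (bigD1 (tnth Q t)) //= big1 ?addr0; last first.
  by move=> v /negPf hv; rewrite E hv !mul0r mulr0.
rewrite E eqxx mulrA ler_wpM2r // mulrA mulr1 ler_pdivrMr ?vfactor_gt0 //.
by rewrite -hx; apply: dunif_choices_le; rewrite hx.
Qed.

Lemma expect_potential_embed_seq (i : 'I_k) prev todo psi x0 Q D :
  (i.+1 < k)%N -> ((part x0).+1 < k)%N -> uniq todo ->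
  (forall y, y \in todo -> part y = i /\ y \notin D) ->
  (forall y, y \in D -> (i <= part y)%N) ->
  expect (embed_seq R G V e i prev todo psi)
    (potential x0 Q (D :|: [set y in todo])) <= potential x0 Q D psi.
Proof.
move=> hi hx0; elim: todo prev psi D => [|x todo IH] prev psi D.
  by move=> _ _ _ /=; rewrite expect_dret set_nil setU0.
move=> /= /andP [xtodo utodo] htodo hD; rewrite expect_dbind.
have [hx xD] := htodo x (mem_head _ _).
apply: le_trans (@expect_potential_step i prev x psi x0 Q D hi hx0 hx xD hD).
apply: ler_expect (subdist_dunif _ _) _ => v _.
rewrite -/(upd psi x v) set_cons setUCA setUA; apply: IH => // y.
  move=> hy; have [|-> yD] := htodo y; first by rewrite inE hy orbT.
  split=> //; rewrite !inE negb_or yD andbT.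
  by apply: contraNneq xtodo => <-.
by rewrite !inE => /orP [/eqP ->|]; [rewrite hx | apply: hD].
Qed.

(** * What holds for every map in the support of a run *)

Lemma choices_agree (i : 'I_k) s x psi psi' :
  ((part x).+1 < k)%N -> (forall z, z \in s -> psi z = psi' z) ->
  (forall z, (part x < part z)%N -> psi z = psi' z) ->
  choices G V e i s x psi = choices G V e i s x psi'.
Proof.
move=> hx hs hz; rewrite /choices (@map_tuple_agree psi psi'); last first.
  by move=> z ze; apply: hz; apply: e_later.
by have /eq_in_map -> : {in s, psi =1 psi'} by [].
Qed.

(** The drawing set may be computed from the final map [psi'] instead of the intermediate one: it
    depends only on earlier vertices of the same part and on later parts, none of which is modified
    afterwards. *)
Lemma embed_seq_neq0 (i : 'I_k) prev todo psi psi' :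
  (i.+1 < k)%N -> uniq (prev ++ todo) -> (forall y, y \in todo -> part y = i) ->
  embed_seq R G V e i prev todo psi psi' != 0 ->
  (forall y, y \notin todo -> psi' y = psi y) /\
  (forall s1 x s2, todo = s1 ++ x :: s2 ->
    psi' x \in choices G V e i (prev ++ s1) x psi').
Proof.
move=> hi; elim: todo prev psi => [|x todo IH] prev psi /=.
  by move=> _ _ /dret_neq0 ->; split=> // s1 x s2; case: s1.
move=> u hpart /dbind_neq0 [v /dunif_neq0 vC].
have hx : part x = i by apply: hpart; rewrite mem_head.
rewrite -/(upd psi x v) => /IH [|y hy|agree run].
- by rewrite cat_rcons.
- by apply: hpart; rewrite inE hy orbT.
have xtodo : x \notin todo by move: u; rewrite cat_uniq => /and4P [].
have agree' y : y \notin x :: todo -> psi' y = psi y.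
  by rewrite inE negb_or => /andP [/negPf yx yt]; rewrite agree // updE yx.
split=> // s1 y s2; case: s1 => [|z s1] [yx tdef]; last first.
  by rewrite -yx -cat_rcons; apply: run tdef.
rewrite -yx agree // updE eqxx cats0 (@choices_agree _ _ _ _ psi) ?hx // => z hz.
  apply: agree'; apply: contraL hz => zt; move: u; rewrite cat_uniq => /and3P [_ /hasPn h _].
  exact: h.
by apply: agree'; apply: contraL hz => /hpart ->; rewrite ltnn.
Qed.


(** A record of how W_i was processed, phrased through the final map alone so that it survives the
    embedding of the remaining parts. *)
Definition run_of_block (i : 'I_k) (s : seq VH) psi : Prop :=
  perm_eq s (enum (block part i)) /\
  forall s1 x s2, s = s1 ++ x :: s2 ->
    psi x \in choices G V e i s1 x psi /\
    forall z, z \in s1 ->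
      (defect G ((theta i)%:R : R) (map_tuple psi (e x)) (V i) <=
       defect G ((theta i)%:R : R) (map_tuple psi (e z)) (V i))%E.

Lemma run_of_block_agree (i : 'I_k) s psi psi' :
  (i.+1 < k)%N -> (forall y, (i <= part y)%N -> psi y = psi' y) ->
  run_of_block i s psi -> run_of_block i s psi'.
Proof.
move=> hi h [sP run]; split=> // s1 x s2 sE; have [xC xD] := run _ _ _ sE.
have hs y : y \in s -> part y = i.
  by rewrite (perm_mem sP) mem_enum inE => /eqP.
have hx : part x = i by apply: hs; rewrite sE mem_cat mem_head orbT.
have hs1 z : z \in s1 -> part z = i by move=> hz; apply: hs; rewrite sE mem_cat hz.
have hm z : part z = i -> map_tuple psi (e z) = map_tuple psi' (e z).
  move=> hz; apply: map_tuple_agree => y /e_later; rewrite hz => /(_ hi) /ltnW.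
  exact: h.
split=> [|z hz]; last by rewrite -(hm _ hx) -(hm _ (hs1 _ hz)); apply: xD.
rewrite -h ?hx // -(@choices_agree _ _ _ psi psi') ?hx // => z hz; apply: h.
  by rewrite hs1.
exact: ltnW.
Qed.

(** * The random injection of the last part *)

Context (hlast : forall i : 'I_k,
  i.+1 = k -> (2 * #|block part i| <= #|V i|)%N).
Context (psi0 : {ffun VH -> VG}).

Local Notation start := (start_maps V part psi0).

Lemma start_mapsP psi : reflect
  [/\ forall x, (part x).+1 = k -> psi x \in V (part x),
      forall x, (part x).+1 != k -> psi x = psi0 x &
      forall x y, (part x).+1 = k -> (part y).+1 = k -> psi x = psi y -> x = y]
  (psi \in start).
Proof.
rewrite inE; apply: (iffP andP) => [[/forallP h1 /forallP h2]|[h1 h2 h3]].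
  split=> [x /eqP hx|x /negPf hx|x y /eqP hx /eqP hy /eqP hxy].
  - by have := h1 x; rewrite hx.
  - by have := h1 x; rewrite hx => /eqP.
  - by move/forallP/(_ y): (h2 x); rewrite hx hy hxy => /eqP.
split; apply/forallP => x.
  by case: eqP => [/h1 //|/eqP /h2 ->].
apply/forallP => y; apply/implyP => /andP [/eqP hx /eqP hy]; apply/implyP => /eqP hxy.
by apply/eqP; apply: h3.
Qed.

(* At least half of V_k stays available for psi y once the other vertices of
   W_k are placed. *)
Lemma start_resample y q (X : {ffun VH -> VG} -> R) :
  (part y).+1 = k -> (forall psi, 0 <= X psi) ->
  (forall psi v, X (upd psi y v) = X psi) ->
  (\sum_(psi in start) (psi y == q)%:R * X psi) * #|V (part y)|%:R <=
    2 * \sum_(psi in start) X psi.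
Proof.
move=> hy X0 Xupd.
pose free (psi : {ffun VH -> VG}) : {set VG} :=
  V (part y) :\: (psi @: (block part (part y) :\ y)).
(* Double counting: moving y from q to a free vertex v sends a start map to a start map. The pair is
   recovered from the result, since v is the new value at y and q the old one. *)
pose A := [set p : {ffun VH -> VG} * VG |
  [&& p.1 \in start, p.1 y == q & p.2 \in free p.1]].
pose h (p : {ffun VH -> VG} * VG) := upd p.1 y p.2.
have hinj : {in A &, injective h}.
  move=> [psi v] [psi' v']; rewrite !inE /= => /and3P [_ /eqP hq _] /and3P [_ /eqP hq' _].
  move=> /ffunP E; congr pair.
    apply/ffunP => z; have := E z; rewrite !updE.
    by case: eqP => // -> _; rewrite hq hq'.
  by have := E y; rewrite !updE eqxx.
have hstart p : p \in A -> h p \in start.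
  case: p => psi v; rewrite inE => /and3P [/= /start_mapsP [h1 h2 h3] _].
  rewrite inE => /andP [vfree vV]; apply/start_mapsP.
  have new z : (part z).+1 = k -> z != y -> psi z != v.
    move=> hz zy; apply: contraNneq vfree => <-; apply/imset_f; rewrite !inE zy /=.
    by rewrite -(inj_eq val_inj) /= -eqSS hz hy.
  split=> [x hx|x hx|x z hx hz]; rewrite /h /= !updE.
  - by case: eqP => [->//|_]; apply: h1.
  - by case: eqP => [xy|_]; [rewrite xy hy eqxx in hx | apply: h2].
  case: eqP => [->|/eqP xy]; case: eqP => [->|/eqP zy] //.
  - by move=> /esym/eqP; rewrite (negPf (new _ hz zy)).
  - by move=> /eqP; rewrite (negPf (new _ hx xy)).
  - exact: h3.
have le1 : \sum_(p in A) X (h p) <= \sum_(psi in start) X psi.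
  rewrite -(big_imset X hinj) /= big_mkcond [leRHS]big_mkcond /=.
  apply: ler_sum => psi _; case: imsetP => [[p pA ->]|_].
    by rewrite hstart.
  by case: ifP.
(* The other vertices of W_k occupy fewer than |W_k| <= |V_k| / 2 places. *)
have half psi : (#|V (part y)| <= 2 * #|free psi|)%N.
  have := hlast hy.
  have : (#|block part (part y) :\ y| < #|block part (part y)|)%N.
    by rewrite [X in (_ < X)%N](cardsD1 y) inE eqxx.
  have := leq_imset_card psi (block part (part y) :\ y).
  have := cardsID (psi @: (block part (part y) :\ y)) (V (part y)).
  have := subset_leq_card (subsetIr (V (part y)) (psi @: (block part (part y) :\ y))).
  rewrite -/(free psi); lia.
apply: le_trans (ler_wpM2l (ler0n _ 2) le1).
have -> : \sum_(p in A) X (h p) =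
    \sum_(psi in start) (psi y == q)%:R * X psi * #|free psi|%:R.
  rewrite (eq_bigl (fun p => ((p.1 \in start) && (p.1 y == q)) && (p.2 \in free p.1)));
    last by move=> p; rewrite inE andbA.
  rewrite -(pair_big_dep (fun psi => (psi \in start) && (psi y == q))
    (fun psi v => v \in free psi) (fun psi v => X (upd psi y v))) /=.
  rewrite big_mkcondr /=; apply: eq_bigr => psi _; case: eqP => _; last by rewrite !mul0r.
  rewrite mul1r (eq_bigr (fun=> X psi)) ?sumr_const ?mulr_natr //.
rewrite big_distrl big_distrr /=; apply: ler_sum => psi _.
rewrite mulrCA ler_wpM2l //; first by rewrite mulr_ge0.
by rewrite -natrM ler_nat.
Qed.

Definition embedded (l : seq 'I_k) : {set VH} :=
  [set y | ((part y).+1 == k) || (part y \in l)].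

(** The coordinates are peeled off one at a time: those outside W_k already equal their rate, and
    those in W_k are handled by resampling one vertex. *)
Lemma expect_potential_start x0 Q : ((part x0).+1 < k)%N ->
  expect (dunif R start) (potential x0 Q (embedded [::])) <=
    \prod_(t < d) rate (tnth (e x0) t).
Proof.
move=> hx0; rewrite expect_dunif.
pose fac t psi : R := let y := tnth (e x0) t in
  if (part y).+1 == k then (psi y == tnth Q t)%:R else rate y.
have fac0 t psi : 0 <= fac t psi.
  by rewrite /fac /=; case: ifP => _; rewrite ?ler0n ?rate_ge0.
have E psi : potential x0 Q (embedded [::]) psi = \prod_(t < d) fac t psi.
  apply: eq_bigr => t _; rewrite /= /fac inE orbF; case: eqP => // hy.
  (* On the last part the defect is 0 by convention, so the factor is 1. *)
  by rewrite /vfactor /vdefect hy ltnn maxEle ler10 divr1.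
under eq_bigr do rewrite E.
suff h (r : seq 'I_d) : uniq r -> \sum_(psi in start) \prod_(t <- r) fac t psi <=
    #|start|%:R * \prod_(t <- r) rate (tnth (e x0) t).
  have [->|s0] := eqVneq (#|start|%:R : R) 0.
    by rewrite invr0 mulr0 prodr_ge0 // => t _; exact: rate_ge0.
  by rewrite ler_pdivrMr ?lt0r ?s0 ?ler0n // mulrC h // index_enum_uniq.
elim: r => [_|t r IH /= /andP [tr ur]].
  rewrite [leLHS](eq_bigr (fun=> 1)) ?big_nil ?sumr_const ?mulr1 // => psi _.
  by rewrite big_nil.
rewrite [leLHS](eq_bigr (fun psi => fac t psi * \prod_(t <- r) fac t psi));
  last by move=> psi _; rewrite big_cons.
rewrite big_cons mulrCA.
apply: le_trans (ler_wpM2l (rate_ge0 _) (IH ur)).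
have [hy|/negPf hy] := eqVneq (part (tnth (e x0) t)).+1 k; last first.
  by rewrite big_distrr /=; under eq_bigr do rewrite /fac /= hy.
set y := tnth (e x0) t in hy *.
have V0 : 0 < (#|V (part y)|%:R : R).
  rewrite ltr0n; have := hlast hy.
  have : (0 < #|block part (part y)|)%N by rewrite (cardD1 y) inE eqxx.
  lia.
under eq_bigr do rewrite {1}/fac /= -/y hy eqxx.
rewrite -(ler_pM2r V0).
apply: le_trans (@start_resample y (tnth Q t) (fun psi => \prod_(t <- r) fac t psi) hy _ _) _.
- by move=> psi; apply: prodr_ge0.
(* The remaining coordinates ignore the value at y because the entries of [e x0] are distinct. *)
- move=> psi v; apply: eq_big_seq => t' ht'; rewrite /fac /= updE.
  case: (tnth (e x0) t' =P y) => // ht.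
  by move: tr; rewrite -(tuple_uniqP _ (e_uniq hx0) _ _ ht) ht'.
set S := \sum_(psi in _) _.
have S0 : 0 <= S by apply: sumr_ge0 => psi _; apply: prodr_ge0.
rewrite /rate mulrAC divfK ?gt_eqF // ler_wpM2r // ler_peMr ?ler0n //.
exact: gamma_ge1.
Qed.

(** * The whole process *)

Context (sigma : 'I_k -> {ffun VH -> VG} -> seq VH).
Context (hsigma : valid_orders R G V part theta e sigma).

Local Notation greedy := (greedy_map R G V part e sigma psi0).

Lemma sigma_mem (i : 'I_k) psi y : (i.+1 < k)%N ->
  (y \in sigma i psi) = (part y == i).
Proof.
by move=> hi; have [/perm_mem -> _] := hsigma psi hi; rewrite mem_enum inE.
Qed.

Lemma sigma_uniq (i : 'I_k) psi : (i.+1 < k)%N -> uniq (sigma i psi).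
Proof.
by move=> hi; have [/perm_uniq -> _] := hsigma psi hi; rewrite enum_uniq.
Qed.

Lemma subdist_greedy : subdist greedy.
Proof.
apply: (@foldl_inv _ _ _ (fun _ p => subdist p)); first exact: subdist_dunif.
by move=> l1 i l2 p _ hp; apply: subdist_dbind => // psi; apply: subdist_embed_seq.
Qed.

(** The bound for the random start is carried through all parts by the supermartingale property; the
    last part and the processed ones together exhaust the vertices. *)
Lemma expect_potential_greedy x0 Q : ((part x0).+1 < k)%N ->
  expect greedy (potential x0 Q [set: VH]) <=
    \prod_(t < d) rate (tnth (e x0) t).
Proof.
move=> hx0.
have -> : [set: VH] = embedded (descending_indices k).
  apply/setP => y; rewrite !inE mem_descending_indices.
  by have := ltn_ord (part y); rewrite leq_eqVlt => ->.
suff [] : subdist greedy /\ expect greedy (potential x0 Q (embedded (descending_indices k)))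
  <= \prod_(t < d) rate (tnth (e x0) t) by [].
apply: (@foldl_inv _ _ _ (fun l p => subdist p /\ expect p (potential x0 Q (embedded l)) <=
  \prod_(t < d) rate (tnth (e x0) t))).
  by split; [exact: subdist_dunif | exact: expect_potential_start].
move=> l1 i l2 p /descending_indices_split [hi lt_i] [sp hp]; split.
  by apply: subdist_dbind => // psi; apply: subdist_embed_seq.
rewrite expect_dbind; apply: le_trans hp; apply: ler_expect => // psi _.
have -> : embedded (rcons l1 i) = embedded l1 :|: [set y in sigma i psi].
  by apply/setP => y; rewrite !inE sigma_mem // mem_rcons inE [RHS]orbC orbCA.
apply: expect_potential_embed_seq => //; first exact: sigma_uniq.
  move=> y; rewrite sigma_mem // => /eqP hy; split=> //; rewrite inE hy negb_or.
  by rewrite ltn_eqF //=; apply/negP => /lt_i; rewrite ltnn.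
move=> y; rewrite inE => /orP [/eqP hy|/lt_i /ltnW //].
by rewrite -ltnS hy.
Qed.

Lemma greedy_neq0 psi : greedy psi != 0 ->
  [/\ forall y, (part y).+1 = k -> psi y \in V (part y),
      forall x y, (part x).+1 = k -> (part y).+1 = k -> psi x = psi y -> x = y &
      forall i : 'I_k, (i.+1 < k)%N -> exists s, run_of_block i s psi].
Proof.
suff h : forall psi, greedy psi != 0 ->
  [/\ forall y, (part y).+1 = k -> psi y \in V (part y),
      forall x y, (part x).+1 = k -> (part y).+1 = k -> psi x = psi y -> x = y &
      forall i, i \in descending_indices k -> exists s, run_of_block i s psi].
  by move=> /h [h1 h2 h3]; split=> // i; rewrite -mem_descending_indices; apply: h3.
apply: (@foldl_inv _ _ _ (fun l (p : dist R {ffun VH -> VG}) => forall psi, p psi != 0 ->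
  [/\ forall y, (part y).+1 = k -> psi y \in V (part y),
      forall x y, (part x).+1 = k -> (part y).+1 = k -> psi x = psi y -> x = y &
      forall i, i \in l -> exists s, run_of_block i s psi])).
  by move=> {}psi /dunif_neq0 /start_mapsP [h1 _ h3]; split.
move=> l1 i l2 p lE; have [hi lt_i] := descending_indices_split lE.
move=> hp psi' /dbind_neq0 [{}psi].
move=> /hp [h1 h2 h3] /(embed_seq_neq0 hi) [|y|agree run].
- by rewrite sigma_uniq.
- by rewrite sigma_mem // => /eqP.
have same y : part y != i -> psi' y = psi y by rewrite -(sigma_mem psi) //; apply: agree.
have last_neq y : (part y).+1 = k -> part y != i.
  by move=> hy; apply: contraTneq hi => <-; rewrite hy ltnn.
split.
- by move=> y hy; rewrite same ?last_neq //; apply: h1.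
- by move=> x y hx hy; rewrite !same ?last_neq //; apply: h2.
move=> j; rewrite mem_rcons inE => /orP [/eqP ->|jl1].
  exists (sigma i psi); have [sP sS] := hsigma psi hi; split=> // s1 x s2 sE.
  split; first exact: run sE.
  (* The order was sorted for the map before W_i was embedded; the defects of W_i read later parts
     only, so it stays sorted for the new map. *)
  have hm z : part z = i -> map_tuple psi' (e z) = map_tuple psi (e z).
    move=> hz; apply: map_tuple_agree => y /e_later; rewrite hz => /(_ hi) hy.
    by apply: same; rewrite -(inj_eq val_inj) /= gtn_eqF.
  move=> z hz; have hs y : y \in s1 ++ x :: s2 -> part y = i.
    by rewrite -sE sigma_mem // => /eqP.
  rewrite !hm; try by apply: hs; rewrite mem_cat ?hz ?mem_head ?orbT.
  move: sS; rewrite sorted_pairwise; last by move=> a b c h4 h5; apply: le_trans h5 h4.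
  rewrite sE pairwise_cat => /and3P [/allrelP h _ _].
  by apply: h => //; rewrite mem_head.
have [s hs] := h3 j jl1; exists s; have ij := lt_i _ jl1.
have hj : (j.+1 < k)%N by rewrite -mem_descending_indices /descending_indices lE mem_cat jl1.
apply: run_of_block_agree hs => // y hy; rewrite same //.
by rewrite -(inj_eq val_inj) /= gtn_eqF // (leq_trans ij).
Qed.


(** * Failures of the embedding force large defects *)

Lemma run_of_block_split (i : 'I_k) s psi x :
  run_of_block i s psi -> part x = i -> exists s1 s2, s = s1 ++ x :: s2.
Proof.
move=> [sP _] hx; have : x \in s by rewrite (perm_mem sP) mem_enum inE hx.
by case/splitPr => s1 s2; exists s1, s2.
Qed.

(* If psi y falls on a value taken by an earlier vertex of the same block, then
   the earlier vertices fill more than half of N(psi(e_y);V_i); there are more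
   than |N(psi(e_y);V_i)| / 2 of them, each of defect at least that of y, namely
   theta_i / |N(psi(e_y);V_i)|. *)
Lemma sum_vdefect_of_collision (i : 'I_k) s1 y s2 psi x :
  (i.+1 < k)%N -> (2 * #|block part i| <= theta i)%N ->
  run_of_block i (s1 ++ y :: s2) psi ->
  (forall z, part z = i ->
     common_nbrs G (map_tuple psi (e z)) (V i) != set0) ->
  x \in s1 -> psi x = psi y ->
  (theta i)%:R / 2 <= \sum_(z in block part i) vdefect z psi.
Proof.
move=> hi hsize [sP run] hN xs1 hxy; have [yC hle] := run s1 y s2 erefl.
have hs z : z \in s1 ++ y :: s2 -> part z = i.
  by rewrite (perm_mem sP) mem_enum inE => /eqP.
have hy : part y = i by apply: hs; rewrite mem_cat mem_head orbT.
have hs1 z : z \in s1 -> part z = i by move=> hz; apply: hs; rewrite mem_cat hz.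
have us : uniq (s1 ++ y :: s2) by rewrite (perm_uniq sP) enum_uniq.
have us1 : uniq s1 by move: us; rewrite cat_uniq => /and3P [].
have size_s1 : (size s1 < #|block part i|)%N.
  by rewrite cardE -(perm_size sP) size_cat /= addnS ltnS leq_addr.
set N := common_nbrs G (map_tuple psi (e y)) (V i) in hN.
have N0 : N != set0 by apply: hN.
have hNs1 : (#|N| < 2 * size s1)%N.
  (* Rule (3-3) avoids all earlier values, so a collision means that rule (3-2) was applied. *)
  move: yC; rewrite /choices (negPf N0); case: ltnP => [h _|_]; last first.
    by rewrite inE => /andP [_ /negP []]; apply/mapP; exists x.
  have : (#|N :&: [set v in map psi s1]| <= size s1)%N.
    apply: leq_trans (subset_leq_card (subsetIr _ _)) _.
    by rewrite cardsE -(size_map psi); apply: card_size.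
  move: h; rewrite -/N.
  have -> : [set v in N | v \notin [seq psi i | i <- s1]] =
      N :\: [set v in map psi s1] by apply/setP => v; rewrite !inE andbC.
  have := cardsID [set v in map psi s1] N; lia.
have Npos : 0 < (#|N|%:R : R) by rewrite ltr0n card_gt0.
(* Here |N| < 2 |s1| < 2 |W_i| <= theta_i, so the defect of y is theta_i / |N| and not 0. *)
have hNth : (#|N| < theta i)%N by lia.
have big z : z \in s1 -> (theta i)%:R / #|N|%:R <= vdefect z psi.
  move=> hz; have := hle z hz; rewrite (defectE _ _ (hN _ hy)) (defectE _ _ (hN _ (hs1 _ hz))).
  by rewrite lee_fin /vdefect hs1 // hi {1}/rdefect -/N leqNgt hNth.
apply: (@le_trans _ _ (\sum_(z <- s1) vdefect z psi)); last first.
  rewrite big_uniq //= big_mkcond [leRHS]big_mkcond /=; apply: ler_sum => z _.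
  case: ifP => [hz|_]; first by rewrite inE hs1 // eqxx.
  by case: ifP => // _; apply: vdefect_ge0.
apply: (@le_trans _ _ (\sum_(z <- s1) (theta i)%:R / #|N|%:R)); last first.
  by rewrite big_seq [leRHS]big_seq; apply: ler_sum.
rewrite big_const_seq count_predT iter_addr_0 -[leRHS]mulr_natr -mulrA ler_wpM2l ?ler0n //.
rewrite mulrC ler_pdivlMr // mulrC ler_pdivrMr // -natrM ler_nat; lia.
Qed.

(** Nonempty common neighbourhoods make every edge survive. Two equal values cannot come from
    different parts, by disjointness, nor from the last part, by the choice of the start; within
    another part the sum of defects would be too large. *)
Lemma is_embedding_of_small_defects (H : rel VH) psi :
  (forall i j : 'I_k, i != j -> [disjoint V i & V j]) ->
  symmetric G -> symmetric H -> (forall x y, H x y -> part x != part y) ->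
  (forall x y, H x y -> (part x < part y)%N -> y \in e x) ->
  (forall i : 'I_k, (i.+1 < k)%N -> (2 * #|block part i| <= theta i)%N) ->
  (forall y, psi y \in V (part y)) ->
  (forall x y, (part x).+1 = k -> (part y).+1 = k -> psi x = psi y -> x = y) ->
  (forall i : 'I_k, (i.+1 < k)%N -> exists s, run_of_block i s psi) ->
  (forall x, ((part x).+1 < k)%N ->
     common_nbrs G (map_tuple psi (e x)) (V (part x)) != set0) ->
  (forall i : 'I_k, (i.+1 < k)%N ->
     \sum_(x in block part i) vdefect x psi < (theta i)%:R / 2) ->
  is_embedding H G psi.
Proof.
move=> hV Gsym Hsym hindep He hsize psiV psi_inj runs hN small.
apply/andP; split; last first.
  suff h x y : H x y -> (part x < part y)%N -> G (psi x) (psi y).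
    apply/forallP => x; apply/forallP => y; apply/implyP => Hxy.
    have := hindep _ _ Hxy; rewrite -(inj_eq val_inj) /= neq_ltn => /orP [|lt].
      exact: h.
    by rewrite Gsym; apply: h => //; rewrite Hsym.
  move=> Hxy lt; have hx := leq_ltn_trans lt (ltn_ord (part y)).
  have [s run] := runs _ hx; have [s1 [s2 sE]] := run_of_block_split run erefl.
  have [xC _] := run.2 _ _ _ sE.
  have : psi x \in common_nbrs G (map_tuple psi (e x)) (V (part x)).
    move: xC; rewrite /choices (negPf (hN _ hx)); case: ifP => // _.
    by rewrite inE => /andP [].
  rewrite inE => /andP [_ /allP]; apply.
  by apply: map_f; apply: He.
apply/injectiveP => x y hxy; apply/eqP; apply: contraT => xy.
have [hp|/hV /pred0P /(_ (psi x))] := eqVneq (part x) (part y); last first.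
  by rewrite /= psiV hxy psiV.
have [hk|hx] := eqVneq (part x).+1 k.
  by move: xy; rewrite (psi_inj x y) ?eqxx // -hp.
have {}hx : ((part x).+1 < k)%N by rewrite ltn_neqAle hx ltn_ord.
have [s run] := runs _ hx.
have hN' z : part z = part x ->
    common_nbrs G (map_tuple psi (e z)) (V (part x)) != set0.
  by move=> hz; rewrite -hz; apply: hN; rewrite hz.
(* Stated for an ordered pair, so that it applies whichever of x and y was embedded first. *)
have bad z t : z != t -> psi z = psi t -> part z = part x -> part t = part x ->
    (index z s < index t s)%N -> false.
  move=> zt ezt hz ht lt; have [s1 [s2 sE]] := run_of_block_split run ht.
  have us : uniq s by rewrite (perm_uniq run.1) enum_uniq.
  have zs1 : z \in s1.
    apply: contraLR lt => zs1; rewrite -leqNgt sE !index_cat (negPf zs1).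
    move: us; rewrite sE cat_uniq => /and3P [_ /norP [/negPf -> _] _].
    by rewrite leq_add2l /= eqxx.
  have := small _ hx; rewrite ltNge (@sum_vdefect_of_collision _ s1 t s2 psi z) //.
  - exact: hsize.
  - by rewrite -sE.
have : x \in s by rewrite (perm_mem run.1) mem_enum inE.
case: (ltngtP (index x s) (index y s)) => [lt|lt|].
- by rewrite (bad x y).
- by rewrite (bad y x) // eq_sym.
- move=> h1 h2; have h3 : y \in s by rewrite -index_mem -h1 index_mem.
  by move/negP: xy; case; rewrite -(nth_index x h2) h1 nth_index.
Qed.

(** * Moments of the defects when mu_{4d} is finite *)

Lemma card_target_tuples x :
  #|target_tuples V part e x| = (\prod_(t < d) #|V (part (tnth (e x) t))|)%N.
Proof.
pose F (t : 'I_d) := V (part (tnth (e x) t)).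
have -> : target_tuples V part e x =
    [set Q : d.-tuple VG | finfun_of_tuple Q \in family (fun t => mem (F t))].
  by apply/setP => Q; rewrite !inE; apply: eq_forallb => t; rewrite ffunE.
have -> : [set Q : d.-tuple VG | finfun_of_tuple Q \in family (fun t => mem (F t))] =
    (@finfun_of_tuple VG d) @^-1: [set f in family (fun t => mem (F t))].
  by apply/setP => Q; rewrite !inE.
rewrite on_card_preimset; last first.
  exists (@tuple_of_finfun VG d) => f _;
    [exact: finfun_of_tupleK | exact: tuple_of_finfunK].
by rewrite cardsE card_family foldrE big_map big_enum.
Qed.

Context (mu : R).
Context (hN : forall x (Q : d.-tuple VG), ((part x).+1 < k)%N ->
  Q \in target_tuples V part e x -> common_nbrs G Q (V (part x)) != set0).
Context (hmu : forall x, ((part x).+1 < k)%N ->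
  #|target_tuples V part e x|%:R^-1 * \sum_(Q in target_tuples V part e x)
    rdefect R G (theta (part x)) Q (V (part x)) ^+ (4 * d) <= mu).

Lemma greedy_mem psi y : greedy psi != 0 -> psi y \in V (part y).
Proof.
move=> /greedy_neq0 [h1 _ runs].
have [/h1 //|hk] := eqVneq (part y).+1 k.
have hy : ((part y).+1 < k)%N by rewrite ltn_neqAle hk ltn_ord.
have [s run] := runs _ hy; have [s1 [s2 sE]] := run_of_block_split run erefl.
by have [yC _] := run.2 _ _ _ sE; apply: subsetP yC; apply: choices_sub.
Qed.

Lemma greedy_target psi x :
  greedy psi != 0 -> map_tuple psi (e x) \in target_tuples V part e x.
Proof.
move=> hpsi; rewrite inE; apply/forallP => t; rewrite tnth_map.
exact: greedy_mem.
Qed.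

(** The expectation is split according to the tuple Q taken by psi(e_x). With all vertices embedded,
    the potential is the indicator of this event divided by the product of the factors. *)
Lemma expect_weighted_vdefect x : ((part x).+1 < k)%N ->
  expect greedy (fun psi => vdefect x psi ^+ (4 * d) /
    \prod_(t < d) vfactor (tnth (e x) t) psi) <= (2 * gam) ^+ d * mu.
Proof.
move=> hx; set TT := target_tuples V part e x.
pose F (Q : d.-tuple VG) := rdefect R G (theta (part x)) Q (V (part x)) ^+ (4 * d).
have F0 Q : 0 <= F Q.
  rewrite exprn_ge0 //; case: (rdefect_eq0_or_ge1 R G (theta (part x)) Q (V (part x))).
    by move->.
  exact: le_trans.
have le1 : expect greedy (fun psi => vdefect x psi ^+ (4 * d) /
      \prod_(t < d) vfactor (tnth (e x) t) psi) <=
    expect greedy (fun psi => \sum_(Q in TT) F Q * potential x Q [set: VH] psi).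
  apply: ler_expect subdist_greedy _ => psi hpsi.
  rewrite (bigD1 (map_tuple psi (e x))) ?greedy_target //=.
  rewrite /vdefect hx -[leLHS]addr0; apply: lerD; last first.
    by apply: sumr_ge0 => Q _; rewrite mulr_ge0 ?potential_ge0.
  rewrite le_eqVlt; apply/orP; left; apply/eqP; congr (_ * _).
  rewrite -prodfV; apply: eq_bigr => t _.
  by rewrite /= in_setT tnth_map eqxx mul1r.
apply: le_trans le1 _; rewrite expect_sum.
(* The sizes |V_y| multiply to the number of target tuples, which turns the sum over Q into the
   average bounded by mu. *)
have rateE : \prod_(t < d) rate (tnth (e x) t) = (2 * gam) ^+ d / #|TT|%:R.
  rewrite card_target_tuples natr_prod -prodfV big_split /= prodr_const card_ord //.
apply: (@le_trans _ _ (\sum_(Q in TT) F Q * ((2 * gam) ^+ d / #|TT|%:R))).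
  apply: ler_sum => Q _; rewrite expectZ ler_wpM2l // -rateE.
  exact: expect_potential_greedy.
rewrite -big_distrl /= mulrC -mulrA ler_wpM2l ?hmu //.
by rewrite exprn_ge0 // mulr_ge0 ?ler0n // (le_trans ler01) // gamma_ge1.
Qed.

(** If some defect is nonzero, the largest one is at least 1 and hence bounds each of the d
    factors. *)
Lemma prod_vfactor_le x psi :
  \prod_(t < d) vfactor (tnth (e x) t) psi = 1 \/
  \prod_(t < d) vfactor (tnth (e x) t) psi <=
    \sum_(t < d) vdefect (tnth (e x) t) psi ^+ d.
Proof.
pose w t := vdefect (tnth (e x) t) psi.
have [/forallP w0|/forallPn [t0 wt0]] := boolP [forall t, w t == 0].
  left; rewrite big1 // => t _; rewrite /vfactor -/(w t) (eqP (w0 t)).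
  by rewrite maxEle ler10.
right; case: (@arg_maxP _ R 'I_d t0 xpredT w erefl) => t _ tmax.
have wt1 : 1 <= w t.
  have : w t0 <= w t by apply: tmax.
  apply: le_trans; case: (vdefect_eq0_or_ge1 (tnth (e x) t0) psi) => // h.
  by move: wt0; rewrite /w h eqxx.
apply: (@le_trans _ _ (w t ^+ d)); last first.
  rewrite (bigD1 t) //= lerDl sumr_ge0 // => t' _.
  by rewrite exprn_ge0 // vdefect_ge0.
rewrite -[X in _ ^+ X]card_ord -prodr_const; apply: ler_prod => t' _.
rewrite (ltW (vfactor_gt0 _ _)) /= /vfactor ge_max wt1 /=; exact: tmax.
Qed.

(** The weight 1 / (4d) is small enough for the sum over the d entries of [e x] to be absorbed in
    the induction on parts that follows. *)
Lemma vdefect_pow_le x psi : (0 < d)%N ->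
  vdefect x psi ^+ d <=
    d%:R * (vdefect x psi ^+ (4 * d) / \prod_(t < d) vfactor (tnth (e x) t) psi)
    + (4 * d%:R)^-1 * \sum_(t < d) vdefect (tnth (e x) t) psi ^+ d.
Proof.
move=> hd; have := prod_vfactor_le x psi.
have : 1 <= \prod_(t < d) vfactor (tnth (e x) t) psi.
  apply: (big_ind (fun z : R => 1 <= z)) => // [a b|t _]; first exact: mulr_ege1.
  exact: vfactor_ge1.
have : 0 <= \sum_(t < d) vdefect (tnth (e x) t) psi ^+ d.
  by apply: sumr_ge0 => t _; rewrite exprn_ge0 // vdefect_ge0.
move: (\prod_(t < d) _) (\sum_(t < d) _) => P S S0 P1 hP.
have c1 : 1 <= d%:R :> R by rewrite ler1n.
move: (d%:R : R) c1 => c c1; rewrite mulnC exprM.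
have a01 : vdefect x psi ^+ d = 0 \/ 1 <= vdefect x psi ^+ d.
  case: (vdefect_eq0_or_ge1 x psi) => [->|h]; last by right; apply: exprn_ege1.
  by left; rewrite expr0n gtn_eqF.
move: (_ ^+ d) a01 => a a01.
have P0 : 0 < P by apply: lt_le_trans P1.
have c0 : 0 < c by apply: lt_le_trans c1.
have c40 : 0 < 4 * c by rewrite mulr_gt0.
case: a01 => [->|a1].
  by rewrite expr0n mul0r mulr0 add0r mulr_ge0 // invr_ge0 ltW.
have a2 : a ^+ 2 <= a ^+ 4 by rewrite ler_weXn2l.
case: hP => [->|PS].
  rewrite divr1 -[leLHS]addr0; apply: lerD; last by rewrite mulr_ge0 // invr_ge0 ltW.
  have : a <= a ^+ 4 by rewrite -[leLHS]expr1 ler_weXn2l.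
  by move=> h; apply: le_trans h _; rewrite ler_peMl // exprn_ge0 // (le_trans ler01).
(* AM-GM: [a <= c a^2 / P + P / (4 c)] *)
apply: (@le_trans _ _ (c * (a ^+ 2 / P) + (4 * c)^-1 * P)); last first.
  apply: lerD; last by rewrite ler_wpM2l // invr_ge0 ltW.
  by rewrite ler_wpM2l ?(ltW c0) // ler_wpM2r // invr_ge0 ltW.
rewrite -subr_ge0.
have -> : c * (a ^+ 2 / P) + (4 * c)^-1 * P - a = (2 * c * a - P) ^+ 2 / (4 * c * P).
  by field; rewrite !gt_eqF.
by rewrite divr_ge0 ?sqr_ge0 // mulr_ge0 // ltW.
Qed.

(** Write M = (2 gamma)^d mu. The induction closes because d M + (1 / (4d)) d (2 d M) = (3/2) d M <=
    2 d M. *)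
Lemma expect_vdefect_pow x : (0 < d)%N -> 0 <= mu ->
  expect greedy (fun psi => vdefect x psi ^+ d) <=
    2 * d%:R * ((2 * gam) ^+ d * mu).
Proof.
move=> hd mu0.
have M0 : 0 <= (2 * gam) ^+ d * mu.
  rewrite mulr_ge0 // exprn_ge0 // mulr_ge0 ?ler0n //.
  exact: le_trans ler01 gamma_ge1.
have B0 : 0 <= 2 * d%:R * ((2 * gam) ^+ d * mu).
  by rewrite mulr_ge0 // mulr_ge0 ?ler0n.
have [n hn] := ubnP (k - part x); elim: n x hn => // n IH x hn.
have [hx|hx] := boolP ((part x).+1 < k)%N; last first.
  rewrite /expect big1 // => psi _.
  by rewrite /vdefect (negPf hx) expr0n gtn_eqF // mulr0.
apply: le_trans (ler_expect subdist_greedy (fun psi _ => vdefect_pow_le x psi hd)) _.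
rewrite expectD !expectZ expect_sum.
have d0 : 0 < (d%:R : R) by rewrite ltr0n.
have h1 := ler_wpM2l (ltW d0) (expect_weighted_vdefect hx).
have h2 : \sum_(t < d) expect greedy (fun psi => vdefect (tnth (e x) t) psi ^+ d) <=
    d%:R * (2 * d%:R * ((2 * gam) ^+ d * mu)).
  rewrite -[X in _ <= X%:R * _]card_ord mulr_natl -sumr_const.
  apply: ler_sum => t _; apply: IH.
  rewrite ltnS in hn; apply: leq_trans hn; apply: ltn_sub2l; first exact: ltn_ord.
  exact: e_later hx (mem_tnth t (e x)).
apply: le_trans (lerD h1 (ler_wpM2l _ h2)) _; first by rewrite invr_ge0 mulr_ge0 // ltW.
set M := (2 * gam) ^+ d * mu in M0 *.
have -> : (4 * d%:R)^-1 * (d%:R * (2 * d%:R * M)) = d%:R * M / 2.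
  by field; rewrite gt_eqF.
have : 0 <= d%:R * M by rewrite mulr_ge0 // ltW.
lra.
Qed.

Lemma Pr_not_embedding_le (H : rel VH) : (0 < d)%N -> 0 <= mu ->
  (forall i j : 'I_k, i != j -> [disjoint V i & V j]) ->
  symmetric G -> symmetric H -> (forall x y, H x y -> part x != part y) ->
  (forall x y, H x y -> (part x < part y)%N -> y \in e x) ->
  (forall i : 'I_k, (i.+1 < k)%N -> (2 * #|block part i| <= theta i)%N) ->
  Pr greedy (fun psi => ~~ is_embedding H G psi) <=
    2 ^+ (2 * d + 2) * gam ^+ (2 * d) * mu *
      \sum_(i < k | (i.+1 < k)%N) #|block part i|%:R / (theta i)%:R.
Proof.
move=> hd mu0 hV Gsym Hsym hindep He hsize.
have th0 (i : 'I_k) : (i.+1 < k)%N -> 0 < ((theta i)%:R : R).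
  by move=> hi; rewrite ltr0n theta_gt0.
(* Markov's inequality and the union bound in one function: each summand is nonnegative, and one of
   them reaches 1 as soon as the defects of its part sum to theta_i / 2. *)
pose F psi : R := \sum_(i < k | (i.+1 < k)%N)
  (2 / (theta i)%:R * \sum_(x in block part i) vdefect x psi).
have Fi0 psi (i : 'I_k) : 0 <= 2 / (theta i)%:R * \sum_(x in block part i) vdefect x psi.
  rewrite mulr_ge0 ?divr_ge0 ?ler0n //; apply: sumr_ge0 => x _.
  exact: vdefect_ge0.
apply: (@le_trans _ _ (expect greedy F)).
  apply: Pr_le_expect subdist_greedy _ _ => [psi|psi hpsi].
    by apply: sumr_ge0.
  apply: contraNT; rewrite -ltNge => F1.
  have [_ psi_inj runs] := greedy_neq0 hpsi.
  apply: is_embedding_of_small_defects => //.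
  - by move=> y; apply: greedy_mem.
  - by move=> x hx; apply: hN => //; apply: greedy_target.
  move=> i hi; have : 2 / (theta i)%:R * \sum_(x in block part i) vdefect x psi < 1.
    by apply: le_lt_trans F1; rewrite /F (bigD1 i) //= lerDl sumr_ge0.
  by rewrite mulrAC ltr_pdivrMr ?th0 // mul1r mulrC -ltr_pdivlMr.
rewrite expect_sum big_distrr /=; apply: ler_sum => i hi.
rewrite expectZ expect_sum.
have : \sum_(x in block part i) expect greedy (vdefect x) <=
    #|block part i|%:R * (2 * d%:R * ((2 * gam) ^+ d * mu)).
  rewrite mulr_natl -sumr_const; apply: ler_sum => x _.
  apply: le_trans (expect_vdefect_pow x hd mu0); apply: ler_expect subdist_greedy _.
  move=> psi _; case: (vdefect_eq0_or_ge1 x psi) => [->|h].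
    by rewrite expr0n gtn_eqF.
  by rewrite -[leLHS]expr1 ler_weXn2l.
move=> /(ler_wpM2l (_ : 0 <= 2 / (theta i)%:R)) h; apply: le_trans (h _) _.
  by rewrite divr_ge0 ?ler0n.
set W := #|block part i|%:R; set T := (theta i)%:R^-1.
have -> : 2 * T * (W * (2 * d%:R * ((2 * gam) ^+ d * mu))) =
    (4 * d%:R * (2 * gam) ^+ d) * (mu * (W * T)) by ring.
rewrite -[leRHS]mulrA ler_wpM2r //.
  by rewrite !mulr_ge0 ?invr_ge0 ?ler0n.
have g1 := gamma_ge1.
(* The constant obtained is 4 d (2 gamma)^d; replacing d by 2^d and gamma^d by gamma^(2d) gives the
   stated one. *)
have h1 : (d%:R : R) <= 2 ^+ d by rewrite -natrX ler_nat ltnW // ltn_expl.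
have h2 : gam ^+ d <= gam ^+ (2 * d) by rewrite ler_weXn2l // leq_pmull.
have -> : 2 ^+ (2 * d + 2) = 4 * 2 ^+ d * 2 ^+ d :> R.
  by rewrite exprD mul2n -addnn exprD; ring.
rewrite exprMn !mulrA -[leLHS]mulrA -[leRHS]mulrA; apply: ler_pM => //.
- by rewrite mulr_ge0 ?ler0n.
- by rewrite mulr_ge0 // exprn_ge0 // (le_trans ler01).
- by rewrite ler_wpM2l.
by rewrite ler_wpM2l // exprn_ge0.
Qed.

End Process.

(** * The extended-real average defect *)

Section AverageDefect.

Context (R : realType) (VG : finType) (G : rel VG) (s d theta : nat).

Lemma defect_ge0 (Q : seq VG) (T : {set VG}) :
  (0 <= defect G (theta%:R : R) Q T)%E.
Proof.
rewrite /defect; case: ifP => // _; case: ifP => _; first exact: leey.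
by rewrite lee_fin divr_ge0 ?ler0n.
Qed.

(** A single empty neighbourhood contributes +oo, which the other, nonnegative, terms cannot cancel
    and the positive weight 1 / |QQ| cannot remove. *)
Lemma common_nbrs_neq0_of_avg_defect (QQ : {set d.-tuple VG}) (T : {set VG})
    (m : R) (Q : d.-tuple VG) :
  (0 < theta)%N -> (0 < s)%N ->
  (avg_defect G s theta%:R QQ T <= m%:E)%E -> Q \in QQ ->
  common_nbrs G Q T != set0.
Proof.
move=> th0 s0 hm QQQ; apply: contraTneq hm => N0.
have D : defect G (theta%:R : R) Q T = +oo%E.
  by rewrite /defect N0 cards0 eqxx ler_nat leqNgt th0.
have Ds : (defect G (theta%:R : R) Q T ^+ s = +oo)%E.
  rewrite D; case: s s0 => // n _; elim: n => // n IH.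
  by rewrite expeS IH mulyy.
have -> : avg_defect G s (theta%:R : R) QQ T = +oo%E.
  rewrite /avg_defect (bigD1 Q) //= Ds addye ?gt0_muley //.
    by rewrite lte_fin invr_gt0 ltr0n (cardD1 Q) QQQ.
  rewrite gt_eqF // (lt_le_trans (ltNyr 0)) // sume_ge0 // => Q' _.
  exact/expe_ge0/defect_ge0.
by rewrite leye_eq.
Qed.

Lemma avg_defectE (QQ : {set d.-tuple VG}) (T : {set VG}) :
  (forall Q : d.-tuple VG, Q \in QQ -> common_nbrs G Q T != set0) ->
  avg_defect G s (theta%:R : R) QQ T =
    (#|QQ|%:R^-1 * \sum_(Q in QQ) rdefect R G theta Q T ^+ s)%:E.
Proof.
move=> h; rewrite /avg_defect EFinM -sumEFin; congr (_ * _)%E.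
by apply: eq_bigr => Q QQQ; rewrite defectE ?h // EFin_expe.
Qed.

End AverageDefect.

Theorem theorem4p2 (R : realType) (d k : nat) (hd : (0 < d)%N) (hk : (0 < k)%N)
  (VG : finType) (G : rel VG) (hG : simple_graph G)
  (V : 'I_k -> {set VG})
  (hV : forall i j : 'I_k, i != j -> [disjoint V i & V j])
  (VH : finType) (H : rel VH) (hH : simple_graph H)
  (part : VH -> 'I_k)
  (hindep : forall x y : VH, H x y -> part x != part y)
  (hdeg : forall x : VH, ((part x).+1 < k)%N ->
     (#|later_nbrs part H x| <= d)%N)
  (theta : 'I_k -> nat)
  (htheta : forall i : 'I_k, (i.+1 < k)%N -> (0 < theta i)%N)
  (Hd : rel VH) (hHd : regular_completion part d H Hd)
  (e : VH -> d.-tuple VH) (he : is_ordering_of_later_nbrs part Hd e)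
  (sigma : 'I_k -> {ffun VH -> VG} -> seq VH)
  (hsigma : valid_orders R G V part theta e sigma)
  (psi0 : {ffun VH -> VG})
  (hlast : forall i : 'I_k, i.+1 = k -> (2 * #|block part i| <= #|V i|)%N)
  (hsize : forall i : 'I_k, (i.+1 < k)%N -> (2 * #|block part i| <= theta i)%N) :
  ((Pr (greedy_map R G V part e sigma psi0)
      (fun psi => ~~ is_embedding H G psi))%:E
   <= (2 ^+ (2 * d + 2) * gamma R V theta ^+ (2 * d))%:E
      * mu_max R G V part theta e (4 * d)
      * (\sum_(i < k | (i.+1 < k)%N)
           #|block part i|%:R / (theta i)%:R)%:E)%E.
Proof.
have [Gsym _] := hG; have [Hsym _] := hH.
have e_uniq x : ((part x).+1 < k)%N -> uniq (e x).
  by move=> /he /perm_uniq ->; rewrite enum_uniq.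
have e_later x z : ((part x).+1 < k)%N -> z \in e x -> (part x < part z)%N.
  by move=> /he /perm_mem ->; rewrite mem_enum inE => /andP [].
have He x y : H x y -> (part x < part y)%N -> y \in e x.
  move=> Hxy lt; have hx := leq_ltn_trans lt (ltn_ord (part y)).
  by rewrite (perm_mem (he x hx)) mem_enum inE lt andbT (completion_sub hHd).
have s0 : (0 < 4 * d)%N by rewrite muln_gt0.
have mu_ge0 : (0 <= mu_max R G V part theta e (4 * d))%E by exact: bigmax_ge_id.
have mu_ge x : ((part x).+1 < k)%N ->
    (mu_at R G V part theta e (4 * d) x <= mu_max R G V part theta e (4 * d))%E.
  by move=> hx; apply: le_bigmax_cond.
have g0 : 0 < gamma R V theta by apply: lt_le_trans ltr01 (gamma_ge1 _ _ _).
case E : (mu_max R G V part theta e (4 * d)) mu_ge0 mu_ge => [m| |] // m0 mu_ge.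
  have hN x (Q : d.-tuple VG) : ((part x).+1 < k)%N ->
      Q \in target_tuples V part e x -> common_nbrs G Q (V (part x)) != set0.
    move=> hx; apply: common_nbrs_neq0_of_avg_defect (mu_ge _ hx) => //.
    exact: htheta.
  rewrite -!EFinM lee_fin; apply: Pr_not_embedding_le => //.
  move=> x hx; have := mu_ge x hx; rewrite /mu_at avg_defectE ?lee_fin //.
  by move=> Q; apply: hN.
(* Now mu_{4d} is +oo. A maximum over no vertex would be 0, so some W_i with i < k is nonempty; the
   sum over parts is then positive and the right-hand side is +oo. *)
have [x hx] : exists x, ((part x).+1 < k)%N.
  apply/existsP; apply: contraPT E => /existsPn h.
  by rewrite /mu_max big_pred0 // => x; apply/negbTE/h.
rewrite gt0_muley; last by rewrite lte_fin mulr_gt0 // exprn_gt0.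
rewrite gt0_mulye ?leey // lte_fin (bigD1 (part x)) //= ltr_wpDr //.
  by apply: sumr_ge0 => i _; rewrite divr_ge0 ?ler0n.
rewrite divr_gt0 // ltr0n ?htheta //.
by rewrite (cardD1 x) inE eqxx.
Qed.
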